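(* Let $T$ be a truss. The forgetful functor $U$ from the category of pointed $T$-modules to the category of sets admits a left adjoint $F_T$ given, on objects, by sending any set $X$ to the pointed $T$-module ${\mathrm{R}(T)_u}^{(X)}=\bigoplus_{x\in X}\mathrm{R}(T)_u$, where $\mathrm{R}(T)_u$ is the Dorroh extension of the universal ring $\mathrm{R}(T)$ of $T$.
   Context: An abelian heap is a (possibly empty) set $H$ with a ternary operation $[-,-,-]$ satisfying $[a,b,[c,d,e]]=[[a,b,c],d,e]$, $[a,b,b]=a=[b,b,a]$ and $[a,b,c]=[c,b,a]$; heap morphisms preserve the bracket. A truss is an abelian heap $T$ with an associative binary multiplication such that $t[s,s',s'']=[ts,ts',ts'']$ and $[s,s',s'']t=[st,s't,s''t]$ (not assumed unital, possibly empty). Truss morphisms are multiplicative heap morphisms. Rings are not assumed unital. Every ring $R$ yields a truss $\mathrm{T}(R)$ with the same multiplication and bracket $[a,b,c]=a-b+c$. The universal ring $\mathrm{R}(T)$ of a truss $T$ is a ring with a truss morphism $\iota_T\colon T\to \mathrm{T}(\mathrm{R}(T))$ such that every truss morphism $\varphi\colon T\to \mathrm{T}(R)$, $R$ a ring, factors as $\varphi=\hat\varphi\circ\iota_T$ for a unique ring homomorphism $\hat\varphi\colon \mathrm{R}(T)\to R$. It exists for every $T$ (and is $0$ for $T=\varnothing$). The Dorroh extension $R_u$ of a ring $R$ is the unital ring with a ring homomorphism $\jmath_R\colon R\to R_u$ that is universal among ring homomorphisms from $R$ to unital rings; concretely $R_u=R\oplus\mathbb{Z}$ with $(r,m)(s,n)=(rs+ms+nr,mn)$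 and $\jmath_R(r)=(r,0)$. A pointed $T$-module is an abelian group $G$ with a map $\cdot\colon T\times G\to G$ such that $t\cdot(t'\cdot g)=(tt')\cdot g$, $[t,t',t'']\cdot g=t\cdot g-t'\cdot g+t''\cdot g$ and $t\cdot(g+h)=t\cdot g+t\cdot h$. Morphisms are group homomorphisms $f$ with $f(t\cdot g)=t\cdot f(g)$. The $T$-action on $\bigoplus_{x\in X}\mathrm{R}(T)_u$ is left multiplication by $\jmath_{\mathrm{R}(T)}(\iota_T(t))$ in each component. *)

(* Defs.v *)
From HB Require Import structures.
From mathcomp Require Import all_boot all_algebra generic_quotient.
From mathcomp Require Import boolp classical_sets functions cardinality.

Set Implicit Arguments.
Unset Strict Implicit.
Unset Printing Implicit Defensive.
Import GRing.Theory.
Local Open Scope classical_set_scope.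
Local Open Scope ring_scope.

(* The choiceType structures carried by the library algebraic structures used
   below are no restriction: boolp provides one on every type. *)

HB.mixin Record isAbelianHeap H := {
  tern : H -> H -> H -> H;
  ternA : forall a b c d e, tern a b (tern c d e) = tern (tern a b c) d e;
  ternKr : forall a b, tern a b b = a;
  ternKl : forall a b, tern b b a = a;
  ternC : forall a b c, tern a b c = tern c b a
}.
#[short(type="abelianHeapType")]
HB.structure Definition AbelianHeap := {H of isAbelianHeap H}.

HB.mixin Record isTruss T of AbelianHeap T & Semigroup T := {
  multernr : forall t s s' s'' : T,
    (t * tern s s' s'' = tern (t * s) (t * s') (t * s''))%g;
  multernl : forall t s s' s'' : T,
    (tern s s' s'' * t = tern (s * t) (s' * t) (s'' * t))%g
}.
#[short(type="trussType")]
HB.structure Definition Truss := {T of isTruss T & AbelianHeap T & Semigroup T}.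

Record truss_hom (T T' : trussType) := TrussHom {
  truss_fun :> T -> T';
  truss_homH : forall a b c,
    truss_fun (tern a b c) = tern (truss_fun a) (truss_fun b) (truss_fun c);
  truss_homM : {morph truss_fun : s t / (s * t)%g}
}.

(* Not necessarily unital rings; their product is the semigroup product
   (_ * _)%g, as the (_ * _)%R of the library comes with a unit. *)
HB.mixin Record isRng R of GRing.Zmodule R & Semigroup R := {
  rngDl : forall x y z : R, ((x + y)%R * z)%g = (x * z)%g + (y * z)%g;
  rngDr : forall x y z : R, (x * (y + z)%R)%g = (x * y)%g + (x * z)%g
}.
#[short(type="rngType")]
HB.structure Definition Rng := {R of isRng R & GRing.Zmodule R & Semigroup R}.

Record rng_hom (R S : rngType) := RngHom {
  rng_fun :> R -> S;
  rng_homB : zmod_morphism rng_fun;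
  rng_homM : {morph rng_fun : x y / (x * y)%g}
}.

Lemma rng_hom_eq (R S : rngType) (f g : rng_hom R S) : f =1 g -> f = g.
Proof.
case: f g => [f fB fM] [g gB gM] /= /funext fg.
by case: _ / fg gB gM => gB gM; congr RngHom; apply: Prop_irrelevance.
Qed.

Section RngTheory.
Variable R : rngType.
Implicit Types x y z : R.

Lemma rng_mul0 x : (0%R * x)%g = 0.
Proof. by apply: (@addrI _ (0%R * x)%g); rewrite -rngDl !addr0. Qed.

Lemma rng_mulr0 x : (x * 0%R)%g = 0.
Proof. by apply: (@addrI _ (x * 0%R)%g); rewrite -rngDr !addr0. Qed.

Lemma rng_mulN x y : ((- x)%R * y)%g = - (x * y)%g.
Proof. by apply/eqP; rewrite -addr_eq0 -rngDl addNr rng_mul0. Qed.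

Lemma rng_mulrN x y : (x * (- y)%R)%g = - (x * y)%g.
Proof. by apply/eqP; rewrite -addr_eq0 -rngDr addNr rng_mulr0. Qed.

Lemma rng_mulrnl x y n : ((x *+ n)%R * y)%g = (x * y)%g *+ n.
Proof. by elim: n => [|n IHn]; rewrite ?rng_mul0 // !mulrS rngDl IHn. Qed.

Lemma rng_mulrnr x y n : (x * (y *+ n)%R)%g = (x * y)%g *+ n.
Proof. by elim: n => [|n IHn]; rewrite ?rng_mulr0 // !mulrS rngDr IHn. Qed.

Lemma rng_mulrzl x y (m : int) : ((x *~ m)%R * y)%g = (x * y)%g *~ m.
Proof.
by case: m => n; rewrite ?NegzE ?mulrNz ?rng_mulN -!pmulrn rng_mulrnl.
Qed.

Lemma rng_mulrzr x y (m : int) : (x * (y *~ m)%R)%g = (x * y)%g *~ m.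
Proof.
by case: m => n; rewrite ?NegzE ?mulrNz ?rng_mulrN -!pmulrn rng_mulrnr.
Qed.

End RngTheory.

(* The truss T(R) of a ring R *)
Definition truss_of (R : rngType) : Type := R.
HB.instance Definition _ (R : rngType) := Semigroup.on (truss_of R).

Section TrussOf.
Variable R : rngType.
Let br (a b c : truss_of R) : truss_of R := (a : R) - b + c.
Let brA a b c d e : br a b (br c d e) = br (br a b c) d e.
Proof. by rewrite /br !addrA. Qed.
Let brKr a b : br a b b = a. Proof. by rewrite /br subrK. Qed.
Let brKl a b : br b b a = a. Proof. by rewrite /br subrr add0r. Qed.
Let brC a b c : br a b c = br c b a. 
Proof. by rewrite /br addrC addrCA addrC. Qed.
HB.instance Definition _ :=
  isAbelianHeap.Build (truss_of R) brA brKr brKl brC.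
Let brMr (t s s' s'' : truss_of R) :
  (t * tern s s' s'' = tern (t * s) (t * s') (t * s''))%g.
Proof. by rewrite /tern /= /br [LHS]rngDr [X in X + _]rngDr [X in _ + X + _]rng_mulrN. Qed.
Let brMl (t s s' s'' : truss_of R) :
  (tern s s' s'' * t = tern (s * t) (s' * t) (s'' * t))%g.
Proof. by rewrite /tern /= /br [LHS]rngDl [X in X + _]rngDl [X in _ + X + _]rng_mulN. Qed.
HB.instance Definition _ := isTruss.Build (truss_of R) brMr brMl.
End TrussOf.

Lemma tern_truss_of (R : rngType) (a b c : truss_of R) :
  tern a b c = (a : R) - b + c.
Proof. by []. Qed.

Definition is_universal_ring (T : trussType) (R : rngType)
    (iota : truss_hom T (truss_of R)) : Prop :=
  forall (S : rngType) (phi : truss_hom T (truss_of S)),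
    exists! phihat : rng_hom R S, forall t, phi t = phihat (iota t).

(* The Dorroh extension R_u *)
Definition dorroh (R : rngType) : Type := (R * int)%type.
HB.instance Definition _ (R : rngType) := GRing.Zmodule.on (dorroh R).

Section Dorroh.
Variable R : rngType.
Definition dorroh_one : dorroh R := (0, 1).
Definition dorroh_mul (x y : dorroh R) : dorroh R :=
  ((x.1 * y.1)%g + y.1 *~ x.2 + x.1 *~ y.2, x.2 * y.2).

Let mulA : associative dorroh_mul.
Proof.
case=> [r m] [s n] [t p]; congr pair; last by rewrite /= mulrA.
rewrite /= !rngDl !rngDr !rng_mulrzl !rng_mulrzr mulgA !mulrzDl -!mulrzA.
rewrite [n * m]mulrC [p * m]mulrC !addrA.
by rewrite (AC (1*1*1*1*1*1*1) (1*4*2*5*3*6*7)).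
Qed.

Let mul1r : left_id dorroh_one dorroh_mul.
Proof.
by case=> r m; rewrite /dorroh_mul /= rng_mul0 mul0rz mul1r add0r addr0.
Qed.

Let mulr1 : right_id dorroh_one dorroh_mul.
Proof.
by case=> r m; rewrite /dorroh_mul /= rng_mulr0 mul0rz mulr1 !add0r.
Qed.

Let mulDl : left_distributive dorroh_mul +%R.
Proof.
case=> [r m] [s n] [t p]; congr pair; last by rewrite /= mulrDl.
rewrite /= rngDl mulrzDl mulrzDr !addrA.
by rewrite (AC (1*1*1*1*1*1) (1*3*5*2*4*6)).
Qed.

Let mulDr : right_distributive dorroh_mul +%R.
Proof.
case=> [r m] [s n] [t p]; congr pair; last by rewrite /= mulrDr.
rewrite /= rngDr mulrzDl mulrzDr !addrA.
by rewrite (AC (1*1*1*1*1*1) (1*3*5*2*4*6)).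
Qed.

Let oner_neq0 : dorroh_one != 0. 
Proof. by apply/eqP => /(congr1 snd). Qed.

HB.instance Definition _ := GRing.Zmodule_isNzRing.Build (dorroh R)
  mulA mul1r mulr1 mulDl mulDr oner_neq0.

Definition dorroh_inj (r : R) : dorroh R := (r, 0).

Lemma dorroh_injM r s : dorroh_inj (r * s)%g = dorroh_inj r * dorroh_inj s.
Proof.
apply: (@congr1 _ _ (fun u => (u, 0 : int)) _ _ _).
by rewrite /= !mulr0z !addr0.
Qed.

Lemma dorroh_injB : zmod_morphism dorroh_inj.
Proof. by []. Qed.
End Dorroh.

HB.mixin Record isPointedModule (T : trussType) G of GRing.Zmodule G := {
  act : T -> G -> G;
  actM : forall t t' g, act t (act t' g) = act (t * t')%g g;
  actH : forall t t' t'' g,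
    act (tern t t' t'') g = act t g - act t' g + act t'' g;
  actD : forall t, {morph act t : g h / g + h}
}.
#[short(type="pointedModType")]
HB.structure Definition PointedModule (T : trussType) :=
  {G of isPointedModule T G & GRing.Zmodule G}.

Record pmod_hom (T : trussType) (G H : pointedModType T) := PmodHom {
  pmod_fun :> G -> H;
  pmod_homB : zmod_morphism pmod_fun;
  pmod_homZ : forall t g, pmod_fun (act t g) = act t (pmod_fun g)
}.

(* The direct sum of copies of A indexed by X: finitely supported functions *)
Section DirectSum.
Variables (X : Type) (A : zmodType).

Definition fin_supp : {pred X -> A} :=
  fun f => `[< finite_set [set x | f x != 0] >].

Record dsum := DSum { dsum_fun :> X -> A; dsumP : dsum_fun \in fin_supp }.
HB.instance Definition _ := [isSub for dsum_fun].
HB.instance Definition _ := [Choice of dsum by <:].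

Let fin_supp_zmod : zmod_closed fin_supp.
Proof.
split=> [|f g /asboolP fP /asboolP gP]; apply/asboolP.
  by apply: (@sub_finite_set _ _ set0) => // x /=; rewrite eqxx.
apply: (sub_finite_set (B := [set x | f x != 0] `|` [set x | g x != 0])).
  move=> x /=; case: (eqVneq (f x) 0) => [fx0|]; last by left.
  case: (eqVneq (g x) 0) => [gx0|]; last by right.
  by rewrite [X in X != _](_ : _ = f x - g x) // fx0 gx0 subrr eqxx.
by rewrite finite_setU.
Qed.
HB.instance Definition _ := GRing.isZmodClosed.Build _ fin_supp fin_supp_zmod.
HB.instance Definition _ := [SubChoice_isSubZmodule of dsum by <:].
End DirectSum.

(* R_u^(X), acted upon by T through iota; iota is a parameter of the type since
   the action depends on it. *)
Definition free_mod (T : trussType) (R : rngType)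
  (iota : truss_hom T (truss_of R)) (X : Type) : Type := dsum X (dorroh R).
HB.instance Definition _ T R (iota : truss_hom T (truss_of R)) X :=
  GRing.Zmodule.on (free_mod iota X).

Section FreeModule.
Variables (T : trussType) (R : rngType) (iota : truss_hom T (truss_of R)).
Variable X : Type.
Implicit Types (t : T) (f : free_mod iota X).

Let scale t (f : X -> dorroh R) : X -> dorroh R :=
  fun x => dorroh_inj (iota t) * f x.

Fact scale_fin_supp t f : scale t (dsum_fun f) \in @fin_supp X (dorroh R).
Proof.
apply/asboolP; have /asboolP := dsumP f; apply: sub_finite_set => x /=.
by apply: contra_neq; rewrite /scale => ->; rewrite mulr0.
Qed.

Definition free_act t f : free_mod iota X := DSum (scale_fin_supp t f).

Let eq_free f g : dsum_fun f =1 dsum_fun g -> f = g.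
Proof. by move=> /funext fg; apply: val_inj. Qed.

Let free_actM t t' f : free_act t (free_act t' f) = free_act (t * t')%g f.
Proof.
by apply: eq_free => x /=; rewrite /scale mulrA truss_homM dorroh_injM.
Qed.

Let free_actH t t' t'' f :
  free_act (tern t t' t'') f = free_act t f - free_act t' f + free_act t'' f.
Proof.
apply: eq_free => x; rewrite [LHS]/= /scale truss_homH.
rewrite -[RHS]/(dorroh_inj (iota t) * dsum_fun f x
  - dorroh_inj (iota t') * dsum_fun f x + dorroh_inj (iota t'') * dsum_fun f x).
by rewrite -mulrBl -mulrDl; congr (_ * _).
Qed.

Let free_actD t : {morph free_act t : f g / f + g}.
Proof. by move=> f g; apply: eq_free => x; apply: mulrDr. Qed.

HB.instance Definition _ := isPointedModule.Build T (free_mod iota X)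
  free_actM free_actH free_actD.
End FreeModule.

Record category := Category {
  obj :> Type;
  hom : obj -> obj -> Type;
  idm : forall a, hom a a;
  comp : forall a b c, hom b c -> hom a b -> hom a c;
  comp1m : forall a b (f : hom a b), comp (idm b) f = f;
  compm1 : forall a b (f : hom a b), comp f (idm a) = f;
  compA : forall a b c d (h : hom c d) (g : hom b c) (f : hom a b),
    comp h (comp g f) = comp (comp h g) f
}.
Arguments idm {_} a.

Record functor (C D : category) := Functor {
  fobj :> C -> D;
  fmap : forall a b, hom a b -> hom (fobj a) (fobj b);
  fmap1 : forall a, fmap (idm a) = idm (fobj a);
  fmapM : forall a b c (g : hom b c) (f : hom a b),
    fmap (comp g f) = comp (fmap g) (fmap f)
}.
Arguments fmap {C D} F {a b} : rename.

Definition is_left_adjoint (C D : category) (F : functor C D)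
    (U : functor D C) : Prop :=
  exists Phi : forall (x : C) (y : D), hom (F x) y -> hom x (U y),
    (forall x y, bijective (Phi x y)) /\
    (forall x x' y y' (a : hom x' x) (b : hom y y') (f : hom (F x) y),
       Phi x' y' (comp b (comp f (fmap F a))) =
       comp (fmap U b) (comp (Phi x y f) a)).

Definition Sets : category :=
  @Category Type (fun X Y => X -> Y) (fun X => id) (fun X Y Z g f => g \o f)
    (fun _ _ _ => erefl) (fun _ _ _ => erefl) (fun _ _ _ _ _ _ _ => erefl).

Section PMod.
Variable T : trussType.
Implicit Types G H K L : pointedModType T.

Lemma pmod_hom_eq G H (f g : pmod_hom G H) : f =1 g -> f = g.
Proof.
case: f g => [f fB fZ] [g gB gZ] /= /funext fg.
by case: _ / fg gB gZ => gB gZ; congr PmodHom; apply: Prop_irrelevance.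
Qed.

Definition pmod_id G : pmod_hom G G :=
  @PmodHom T G G id (fun _ _ => erefl) (fun _ _ => erefl).

Fact pmod_comp_zmod G H K (g : pmod_hom H K) (f : pmod_hom G H) :
  zmod_morphism (g \o f).
Proof. by move=> x y /=; rewrite !pmod_homB. Qed.

Fact pmod_comp_act G H K (g : pmod_hom H K) (f : pmod_hom G H) t x :
  (g \o f) (act t x) = act t ((g \o f) x).
Proof. by rewrite /= !pmod_homZ. Qed.

Definition pmod_comp G H K (g : pmod_hom H K) (f : pmod_hom G H) :
  pmod_hom G K := PmodHom (pmod_comp_zmod g f) (pmod_comp_act g f).

Let pmod_comp1m G H (f : pmod_hom G H) : pmod_comp (pmod_id H) f = f.
Proof. exact: pmod_hom_eq. Qed.
Let pmod_compm1 G H (f : pmod_hom G H) : pmod_comp f (pmod_id G) = f.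
Proof. exact: pmod_hom_eq. Qed.
Let pmod_compA G H K L (h : pmod_hom K L) (g : pmod_hom H K)
  (f : pmod_hom G H) : pmod_comp h (pmod_comp g f) = pmod_comp (pmod_comp h g) f.
Proof. exact: pmod_hom_eq. Qed.

Definition PMod : category := Category pmod_comp1m pmod_compm1 pmod_compA.

Definition forget : functor PMod Sets :=
  @Functor PMod Sets (fun G : pointedModType T => G : Type)
    (fun G H (f : pmod_hom G H) => f : G -> H)
    (fun _ => erefl) (fun _ _ _ _ _ => erefl).
End PMod.

(* Every truss has a universal ring: formal ring expressions in elements of T,
   identified when they take the same value in every ring. *)
Section UniversalRing.
Variable T : trussType.

Inductive rexpr : Type :=
| RVar of T | RZero | ROpp of rexpr | RAdd of rexpr & rexpr
| RMul of rexpr & rexpr.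
HB.instance Definition _ := gen_eqMixin rexpr.
HB.instance Definition _ := gen_choiceMixin rexpr.

Fixpoint reval (S : rngType) (phi : T -> S) (e : rexpr) : S :=
  match e with
  | RVar t => phi t
  | RZero => 0
  | ROpp a => - reval phi a
  | RAdd a b => reval phi a + reval phi b
  | RMul a b => (reval phi a * reval phi b)%g
  end.

Definition req (a b : rexpr) : bool :=
  `[< forall (S : rngType) (phi : truss_hom T (truss_of S)),
        reval phi a = reval phi b >].

Let req_equiv : equiv_class_of req.
Proof.
split=> [a|a b|b a c]; first exact/asboolP.
  by apply/asboolP/asboolP => ab S phi; rewrite ab.
by move=> /asboolP ab /asboolP bc; apply/asboolP => S phi; rewrite ab.
Qed.
Canonical req_equiv_rel := EquivRelPack req_equiv.

Definition uring : Type := {eq_quot req_equiv_rel}%qT.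
HB.instance Definition _ := Choice.on uring.

Definition ucl (a : rexpr) : uring := (\pi_({eq_quot req_equiv_rel}) a)%qT.
Definition ueval (S : rngType) (phi : truss_hom T (truss_of S))
  (u : uring) : S := reval phi (repr (u : {eq_quot req_equiv_rel}%qT)).

Fact uclP a b : reflect
  (forall (S : rngType) (phi : truss_hom T (truss_of S)),
     reval phi a = reval phi b)
  (ucl a == ucl b).
Proof.
by apply: (iffP eqP) => [/eqmodP/asboolP|ab] //; apply/eqmodP/asboolP.
Qed.

Fact reprK' (u : uring) : ucl (repr (u : {eq_quot req_equiv_rel}%qT)) = u.
Proof. exact: reprK. Qed.

Fact uevalK S (phi : truss_hom T (truss_of S)) a :
  ueval phi (ucl a) = reval phi a.
Proof. by move: S phi; apply/uclP; rewrite reprK'. Qed.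

Fact ueval_inj (u v : uring) :
  (forall S (phi : truss_hom T (truss_of S)), ueval phi u = ueval phi v) ->
  u = v.
Proof. by move=> uv; rewrite -[u]reprK' -[v]reprK'; apply/eqP/uclP. Qed.

Let urepr (u : uring) : rexpr := repr (u : {eq_quot req_equiv_rel}%qT).
Definition uzero : uring := ucl RZero.
Definition uopp u := ucl (ROpp (urepr u)).
Definition uadd u v := ucl (RAdd (urepr u) (urepr v)).
Definition umul u v := ucl (RMul (urepr u) (urepr v)).

Section Eval.
Variables (S : rngType) (phi : truss_hom T (truss_of S)).
Fact ueval0 : ueval phi uzero = 0. Proof. exact: uevalK. Qed.
Fact uevalN u : ueval phi (uopp u) = - ueval phi u.
Proof. exact: uevalK. Qed.
Fact uevalD u v : ueval phi (uadd u v) = ueval phi u + ueval phi v.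
Proof. exact: uevalK. Qed.
Fact uevalM u v : ueval phi (umul u v) = (ueval phi u * ueval phi v)%g.
Proof. exact: uevalK. Qed.
End Eval.
Let uevalE := (ueval0, uevalN, uevalD, uevalM).

Let uaddA : associative uadd.
Proof. by move=> u v w; apply: ueval_inj => S f; rewrite !uevalE addrA. Qed.
Let uaddC : commutative uadd.
Proof. by move=> u v; apply: ueval_inj => S f; rewrite !uevalE addrC. Qed.
Let uadd0 : left_id uzero uadd.
Proof. by move=> u; apply: ueval_inj => S f; rewrite !uevalE add0r. Qed.
Let uaddN : left_inverse uzero uopp uadd.
Proof. by move=> u; apply: ueval_inj => S f; rewrite !uevalE addNr. Qed.
HB.instance Definition _ := GRing.isZmodule.Build uring uaddA uaddC uadd0 uaddN.

Let umulA : associative umul.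
Proof. by move=> u v w; apply: ueval_inj => S f; rewrite !uevalE mulgA. Qed.
HB.instance Definition _ := isSemigroup.Build uring umulA.

Let umulDl (u v w : uring) : ((u + v)%R * w)%g = (u * w)%g + (v * w)%g.
Proof. by apply: ueval_inj => S f; rewrite !uevalE rngDl. Qed.
Let umulDr (u v w : uring) : (u * (v + w)%R)%g = (u * v)%g + (u * w)%g.
Proof. by apply: ueval_inj => S f; rewrite !uevalE rngDr. Qed.
HB.instance Definition _ := isRng.Build uring umulDl umulDr.

Let uvar (t : T) : truss_of uring := ucl (RVar t).
Let uvarH a b c : uvar (tern a b c) = tern (uvar a) (uvar b) (uvar c).
Proof.
rewrite tern_truss_of; apply: ueval_inj => S f.
by rewrite !uevalE !uevalK /= truss_homH tern_truss_of.
Qed.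
Let uvarM : {morph uvar : s t / (s * t)%g}.
Proof.
by move=> s t; apply: ueval_inj => S f; rewrite [RHS]uevalM !uevalK /= truss_homM.
Qed.

Definition uring_iota : truss_hom T (truss_of uring) := TrussHom uvarH uvarM.

Theorem uring_universal : is_universal_ring uring_iota.
Proof.
move=> S phi.
have evB : zmod_morphism (ueval phi) by move=> u v; rewrite !uevalE.
have evM : {morph ueval phi : u v / (u * v)%g} by move=> u v; rewrite uevalM.
exists (RngHom evB evM); split=> [t|g gP]; first by rewrite /= uevalK.
case: g gP => g gB gM /= gP.
have g0 : g 0 = 0 by rewrite -(subrr 0) gB subrr.
have gN u : g (- u) = - g u by rewrite -sub0r gB g0 sub0r.
have gD u v : g (u + v) = g u + g v by rewrite -{1}[v]opprK gB gN opprK.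
have eg : ueval phi = g.
  apply/funext=> u; rewrite -[u]reprK' uevalK.
  elim: (repr _) => [t||a IHa|a IHa b IHb|a IHa b IHb] /=.
  - exact: gP.
  - exact: esym g0.
  - rewrite IHa -gN; congr g; apply: ueval_inj => V f.
    by rewrite uevalN !uevalK.
  - rewrite IHa IHb -gD; congr g; apply: ueval_inj => V f.
    by rewrite uevalD !uevalK.
  - rewrite IHa IHb -gM; congr g; apply: ueval_inj => V f.
    by rewrite uevalM !uevalK.
by apply: rng_hom_eq => u; rewrite /= eg.
Qed.
End UniversalRing.

(* Main.v *)
(* A T-action on an abelian group G is a truss morphism from T to T(End G),
   hence a ring morphism from R(T) to End G; adding the integers, R(T)_u acts on
   G. A function v : X -> G then extends to R(T)_u^(X) by f |-> sum_x f(x).v(x).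
   This extension is unique: as R(T) is generated by the image of T, every
   morphism of pointed T-modules is R(T)_u-linear, and the basis vectors span
   R(T)_u^(X) over R(T)_u. *)

From HB Require Import structures.
Require Import Defs.
From mathcomp Require Import all_boot all_algebra.
From mathcomp Require Import finmap boolp classical_sets functions cardinality.
From mathcomp Require Import fsbigop.

Set Implicit Arguments.
Unset Strict Implicit.
Unset Printing Implicit Defensive.
Import GRing.Theory.
Local Open Scope ring_scope.

HB.instance Definition _ (R S : rngType) (f : rng_hom R S) :=
  GRing.isZmodMorphism.Build R S f (rng_homB f).

HB.instance Definition _ (T : trussType) (G H : pointedModType T)
  (f : pmod_hom G H) := GRing.isZmodMorphism.Build G H f (pmod_homB f).

(** * The endomorphism ring of an abelian group *)

Section EndRing.
Variable G : zmodType.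

(** A predicate on the pointwise group [G -> G], so that endomorphisms inherit their addition as a
    subgroup. *)
Definition is_zend : {pred G -> G} := fun f => `[< zmod_morphism f >].

Record zend := ZEnd { zend_fun :> G -> G; zendP : zend_fun \in is_zend }.
HB.instance Definition _ := [isSub for zend_fun].
HB.instance Definition _ := [Choice of zend by <:].

Let is_zend_zmod : zmod_closed is_zend.
Proof.
split=> [|f g /asboolP fB /asboolP gB]; apply/asboolP=> x y.
  exact: esym (subr0 _).
rewrite -[LHS]/(f (x - y) - g (x - y)).
rewrite -[RHS]/((f x - g x) - (f y - g y)).
by rewrite fB gB !opprD !opprK addrACA.
Qed.
HB.instance Definition _ := GRing.isZmodClosed.Build _ is_zend is_zend_zmod.
HB.instance Definition _ := [SubChoice_isSubZmodule of zend by <:].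

Lemma zend_eq (f g : zend) : f =1 g -> f = g.
Proof. by move=> /funext fg; apply: val_inj. Qed.

Fact zend_is_zmod_morphism (f : zend) : zmod_morphism f.
Proof. exact/asboolP/zendP. Qed.
HB.instance Definition _ (f : zend) :=
  GRing.isZmodMorphism.Build G G f (zend_is_zmod_morphism f).

Lemma zendD (f g : zend) x : (f + g) x = f x + g x. Proof. by []. Qed.
Lemma zendB (f g : zend) x : (f - g) x = f x - g x. Proof. by []. Qed.

Definition zend_eval x (f : zend) := f x.
HB.instance Definition _ x := GRing.isZmodMorphism.Build zend G (zend_eval x)
  (fun f g => zendB f g x).
Lemma zendMz (f : zend) (m : int) x : (f *~ m) x = f x *~ m.
Proof. exact: (raddfMz (zend_eval x)). Qed.

Fact zend_comp_subproof (f g : zend) : f \o g \in is_zend.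
Proof. by apply/asboolP=> x y /=; rewrite !raddfB. Qed.
Definition zend_comp (f g : zend) : zend := ZEnd (zend_comp_subproof f g).

Let zend_compA : associative zend_comp.
Proof. by move=> f g h; apply: zend_eq. Qed.
HB.instance Definition _ := isSemigroup.Build zend zend_compA.

Let zend_compDl (f g h : zend) : ((f + g)%R * h)%g = (f * h)%g + (g * h)%g.
Proof. exact: zend_eq. Qed.
Let zend_compDr (f g h : zend) : (f * (g + h)%R)%g = (f * g)%g + (f * h)%g.
Proof. by apply: zend_eq => x; rewrite -[LHS]/(f (g x + h x)) raddfD. Qed.
HB.instance Definition _ := isRng.Build zend zend_compDl zend_compDr.

Lemma zendM (f g : zend) x : (f * g)%g x = f (g x). Proof. by []. Qed.
End EndRing.

(** * Module structures as truss morphisms into endomorphism rings *)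

Section ActEnd.
Variables (T : trussType) (G : pointedModType T).

Fact act_is_zend t : act t \in @is_zend G.
Proof.
apply/asboolP=> g h; apply: (@addIr _ (act t h)).
by rewrite -actD !subrK.
Qed.
Definition act_end t : truss_of (zend G) := ZEnd (act_is_zend t).

Fact act_endH a b c :
  act_end (tern a b c) = tern (act_end a) (act_end b) (act_end c).
Proof. by apply: zend_eq => g; rewrite [LHS]actH. Qed.
Fact act_endM : {morph act_end : s t / (s * t)%g}.
Proof. by move=> s t; apply: zend_eq => g; rewrite [RHS]actM. Qed.
Definition act_hom : truss_hom T (truss_of (zend G)) :=
  TrussHom act_endH act_endM.

HB.instance Definition _ t := GRing.isZmodMorphism.Build G G (act t)
  (zend_is_zmod_morphism (act_end t)).
End ActEnd.

(* By the universal property, R is isomorphic to [uring T], whose elements are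
   classes of expressions, on which one can argue by induction. *)
Lemma universal_ring_ind (T : trussType) (R : rngType)
    (iota : truss_hom T (truss_of R)) (Runiv : is_universal_ring iota)
    (P : R -> Prop) :
  (forall t, P (iota t)) -> P 0 -> (forall x y, P x -> P y -> P (x - y)) ->
  (forall x y, P x -> P y -> P (x * y)%g) -> forall r, P r.
Proof.
move=> Pi P0 PB PM r.
have [g [gi _]] := Runiv _ (uring_iota T).
have evgB : zmod_morphism (ueval iota \o g).
  by move=> x y; rewrite /= rng_homB -(uevalN iota) -(uevalD iota).
have evgM : {morph ueval iota \o g : x y / (x * y)%g}.
  by move=> x y; rewrite /= rng_homM -(uevalM iota).
have idM : {morph @idfun R : x y / (x * y)%g} by [].
have idB : zmod_morphism (@idfun R) by [].
have [i [_ iP]] := Runiv _ iota.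
(* The composite through [uring T] and the identity both fix [iota], so uniqueness in the universal
   property of [R] identifies them. *)
have evgK : ueval iota (g r) = r.
  transitivity (i r); last by rewrite (iP (RngHom idB idM)).
  by rewrite (iP (RngHom evgB evgM)) // => t; rewrite /= -gi uevalK.
rewrite -evgK /ueval; elim: (repr _) => //= [a Pa|a Pa b Pb|a Pa b Pb].
(* Closure is given for differences: [- a] is [0 - a], and [a + b] is [a - (0 - b)]. *)
- by rewrite -sub0r; apply: PB.
- by rewrite -[X in _ + X]opprK -[X in _ - X]sub0r; exact: PB Pa (PB _ _ P0 Pb).
- exact: PM.
Qed.

(** * The Dorroh extension and its action *)

Section DorrohDecomposition.
Variable R : rngType.

Definition dorroh_int (m : int) : dorroh R := (0, m).
Fact dorroh_intB : zmod_morphism dorroh_int.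
Proof. by move=> m n; congr pair; rewrite subrr. Qed.
HB.instance Definition _ :=
  GRing.isZmodMorphism.Build int (dorroh R) dorroh_int dorroh_intB.

Lemma dorrohE (a : dorroh R) : a = dorroh_inj a.1 + 1 *~ a.2.
Proof.
have -> : 1 *~ a.2 = dorroh_int a.2.
  by rewrite -[in RHS](intz a.2) (raddfMz dorroh_int).
by case: a => r m; congr pair; rewrite ?addr0 ?add0r.
Qed.
End DorrohDecomposition.

Section DorrohAction.
Variables (R : rngType) (G : zmodType) (rho : rng_hom R (zend G)).
Implicit Types (a b : dorroh R) (g : G).

(** The action of [(r, m)] on [g]; the vector comes first so that [dact g] is an additive map on
    [dorroh R]. *)
Definition dact g a : G := rho a.1 g + g *~ a.2.

Lemma dactBl g : zmod_morphism (dact g).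
Proof.
move=> a b; rewrite /dact -[(a - b).1]/(a.1 - b.1) -[(a - b).2]/(a.2 - b.2).
by rewrite raddfB zendB mulrzBr opprD addrACA.
Qed.

Lemma dact1 g : dact g 1 = g.
Proof. by rewrite /dact raddf0 add0r. Qed.

(** Associativity for left factors [(r, 0)], the elements through which [T] acts on the free
    module. *)
Lemma dactM r a g : dact g (dorroh_inj r * a) = rho r (dact g a).
Proof.
rewrite /dact -[(_ * a).1]/((r * a.1)%g + a.1 *~ 0 + r *~ a.2).
rewrite -[(_ * a).2]/(0 * a.2) mul0r !mulr0z !addr0 (raddfD rho) zendD.
by rewrite raddfD /= rng_homM zendM !raddfMz zendMz.
Qed.
HB.instance Definition _ g :=
  GRing.isZmodMorphism.Build (dorroh R) G (dact g) (dactBl g).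
End DorrohAction.

(** * Coordinates and basis vectors of the direct sum *)

Section FreeModuleBasis.
Variables (T : trussType) (R : rngType) (iota : truss_hom T (truss_of R)).
Variable X : Type.
Implicit Types (f : free_mod iota X) (x y : X).

Lemma free_mod_eq f f' : dsum_fun f =1 dsum_fun f' -> f = f'.
Proof. by move=> /funext ff'; apply: val_inj. Qed.

Definition coord y f : dorroh R := dsum_fun f y.
Fact coordB y : zmod_morphism (coord y).
Proof. by []. Qed.
HB.instance Definition _ y :=
  GRing.isZmodMorphism.Build (free_mod iota X) (dorroh R) (coord y) (coordB y).

Lemma coord_act t y f : coord y (act t f) = dorroh_inj (iota t) * coord y f.
Proof. by []. Qed.

Fact single_fin_supp x (a : dorroh R) :
  (fun y => if `[< y = x >] then a else 0) \in @fin_supp X (dorroh R).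
Proof.
apply/asboolP; apply: (@sub_finite_set _ _ [set x]%classic) => //= y.
by rewrite /mkset; case: (asboolP (y = x)); rewrite ?eqxx.
Qed.
(** The basis vector at [x] is [single x 1]. Equality on [X] is decided classically, as [X] is an
    arbitrary type. *)
Definition single x a : free_mod iota X := DSum (single_fin_supp x a).

Lemma coord_single x a y : coord y (single x a) = if `[< y = x >] then a else 0.
Proof. by []. Qed.

Fact singleB x : zmod_morphism (single x).
Proof.
move=> a b; apply: free_mod_eq => y; rewrite -!/(coord y _) coordB.
by rewrite !coord_single; case: (asboolP (y = x)); rewrite ?subrr.
Qed.
HB.instance Definition _ x :=
  GRing.isZmodMorphism.Build (dorroh R) (free_mod iota X) (single x) (singleB x).

Lemma act_single t x a : act t (single x a) = single x (dorroh_inj (iota t) * a).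
Proof.
apply: free_mod_eq => y; rewrite -!/(coord y _) coord_act !coord_single.
by case: (asboolP (y = x)); rewrite ?mulr0.
Qed.

(** [A] need only contain the support, so it can be enlarged to serve several elements at once. *)
Lemma free_mod_supp f : exists A : {fset {classic X}},
  forall x, (x : {classic X}) \notin A -> coord x f = 0.
Proof.
have /asboolP/(@finite_fsetP {classic X})[A AP] := dsumP f; exists A => x xA.
apply/eqP; apply: contraNT xA => fx.
by have : [set` A]%classic x by rewrite -AP.
Qed.

Lemma free_mod_sum f (A : {fset {classic X}}) :
  (forall x, (x : {classic X}) \notin A -> coord x f = 0) ->
  f = \sum_(x <- A) single x (coord x f).
Proof.
move=> Af; apply: free_mod_eq => y; rewrite -!/(coord y _).
have -> : coord y (\sum_(x <- A) single x (coord x f)) =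
    \sum_(x <- A) if `[< y = x >] then coord x f else 0.
  by rewrite raddf_sum; apply: eq_bigr.
case: (boolP ((y : {classic X}) \in A)) => yA; last first.
  rewrite Af // big_seq big1 // => x xA; rewrite asboolF // => yx.
  by rewrite yx xA in yA.
rewrite (big_fsetD1 (y : {classic X})) //= asboolT // big_seq big1 ?addr0 //.
move=> x; rewrite !inE => /andP[xy _]; rewrite asboolF // => yx.
by rewrite yx eqxx in xy.
Qed.
End FreeModuleBasis.

(** * Unique extension of functions from the basis *)

Section Lift.
Variables (T : trussType) (R : rngType) (iota : truss_hom T (truss_of R)).
Hypothesis Runiv : is_universal_ring iota.

Section RingAction.
Variable G : pointedModType T.

Definition ring_act : rng_hom R (zend G) := projT1 (cid (Runiv (act_hom G))).

Lemma ring_act_iota t g : ring_act (iota t) g = act t g.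
Proof. by rewrite /ring_act; case: cid => rho [/= <-]. Qed.
End RingAction.

Variable X : Type.
Implicit Types (f : free_mod iota X) (x y : X).

(** Linearity over the Dorroh extension: the ring elements that commute with [h] include the image
    of [T] and are closed under differences and products, hence are all of [R]; integer multiples
    are preserved by additivity. *)
Lemma pmod_hom_single (G : pointedModType T) (h : pmod_hom (free_mod iota X) G)
  x a : h (single iota x a) = dact (ring_act G) (h (single iota x 1)) a.
Proof.
have hM r b : h (single iota x (dorroh_inj r * b)) =
    ring_act G r (h (single iota x b)).
  (* [b] stays general: the product case uses the hypothesis for [r] at [dorroh_inj s * b]. *)
  elim/(@universal_ring_ind _ _ _ Runiv): r b
    => [t b|b|r s IHr IHs b|r s IHr IHs b].
  - by rewrite -act_single pmod_homZ ring_act_iota.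
  - by rewrite (mul0r b) !raddf0.
  - by rewrite dorroh_injB mulrBl !raddfB /= IHr IHs.
  - by rewrite dorroh_injM -mulrA IHr IHs rng_homM.
(* Split [a] as [(r, 0)] plus a multiple of [1], and use [hM] with [b = 1]. *)
rewrite {1}(dorrohE a) -[dorroh_inj _]mulr1 !raddfD /= hM; congr (_ + _).
by rewrite !raddfMz.
Qed.

Section LiftDef.
Variables (G : pointedModType T) (v : X -> G).

(** A sum over the finite support of its terms, which avoids choosing a finite set for each [f]. *)
Definition lift_fun f : G :=
  \sum_(x \in [set: {classic X}]%classic) dact (ring_act G) (v x) (coord x f).

Lemma lift_funE f (A : {fset {classic X}}) :
  (forall x, (x : {classic X}) \notin A -> coord x f = 0) ->
  lift_fun f = \sum_(x <- A) dact (ring_act G) (v x) (coord x f).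
Proof. by move=> Af; apply: fsbigTE => x /Af ->; rewrite raddf0. Qed.

Fact lift_funB : zmod_morphism lift_fun.
Proof.
move=> f f'; have [A Af] := free_mod_supp f; have [B Bf] := free_mod_supp f'.
(* The union contains the supports of [f], [f'] and [f - f'], so the three sums share one index
   set. *)
have Uf x : (x : {classic X}) \notin (A `|` B)%fset -> coord x f = 0.
  by rewrite inE negb_or => /andP[/Af].
have Uf' x : (x : {classic X}) \notin (A `|` B)%fset -> coord x f' = 0.
  by rewrite inE negb_or => /andP[_ /Bf].
rewrite !(@lift_funE _ (A `|` B)%fset) //; last first.
  by move=> x xU; rewrite coordB Uf // Uf' // subrr.
by rewrite -sumrB; apply: eq_bigr => x _; rewrite coordB raddfB.
Qed.

Fact lift_fun_act t f : lift_fun (act t f) = act t (lift_fun f).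
Proof.
have [A Af] := free_mod_supp f.
rewrite !(@lift_funE _ A) //; last first.
  by move=> x /Af fx; rewrite coord_act fx mulr0.
rewrite raddf_sum; apply: eq_bigr => x _.
by rewrite coord_act dactM ring_act_iota.
Qed.

Definition lift : pmod_hom (free_mod iota X) G := PmodHom lift_funB lift_fun_act.

Lemma lift_single x : lift (single iota x 1) = v x.
Proof.
rewrite /= (@lift_funE _ [fset (x : {classic X})]%fset); last first.
  by move=> y; rewrite inE => /eqP yx; rewrite coord_single asboolF.
by rewrite big_seq_fset1 coord_single asboolT // dact1.
Qed.
End LiftDef.

(** Each element is a finite sum of [single x a], whose image is fixed by that of [single x 1]
    through [pmod_hom_single]. *)
Lemma pmod_hom_free_eq (G : pointedModType T)
    (h h' : pmod_hom (free_mod iota X) G) :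
  (forall x, h (single iota x 1) = h' (single iota x 1)) -> h = h'.
Proof.
move=> hh'; apply: pmod_hom_eq => f; have [A Af] := free_mod_supp f.
rewrite (free_mod_sum Af) !raddf_sum; apply: eq_bigr => x _.
by rewrite [LHS]pmod_hom_single [RHS]pmod_hom_single hh'.
Qed.
End Lift.

(** * The free functor and the adjunction *)

Section FreeFunctor.
Variables (T : trussType) (R : rngType) (iota : truss_hom T (truss_of R)).
Hypothesis Runiv : is_universal_ring iota.

(** The extension of [a] from basis vectors to basis vectors; the functor laws then follow from
    uniqueness on the basis. *)
Definition free_map (X Y : Type) (a : X -> Y) :
    pmod_hom (free_mod iota X) (free_mod iota Y) :=
  lift Runiv (fun x => single iota (a x) 1).

Fact free_map1 (X : Type) : free_map (@id X) = pmod_id (free_mod iota X).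
Proof. by apply: (pmod_hom_free_eq Runiv) => x; rewrite lift_single. Qed.

Fact free_mapM (X Y Z : Type) (b : Y -> Z) (a : X -> Y) :
  free_map (b \o a) = pmod_comp (free_map b) (free_map a).
Proof.
apply: (pmod_hom_free_eq Runiv) => x.
by rewrite -[RHS]/(free_map b (free_map a _)) !lift_single.
Qed.

Definition free_functor : functor Sets (PMod T) :=
  @Functor Sets (PMod T) (fun X : Type => free_mod iota X : pointedModType T)
    free_map free_map1 free_mapM.
End FreeFunctor.

Theorem proposition3p4 (T : trussType) (R : rngType)
    (iota : truss_hom T (truss_of R)) (Runiv : is_universal_ring iota) :
  exists F : functor Sets (PMod T),
    (forall X : Type, F X = free_mod iota X :> pointedModType T) /\
    is_left_adjoint F (forget T).
Proof.
exists (free_functor Runiv); split=> //.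
(* Transposition restricts a morphism to the basis vectors; its inverse is [lift]. *)
exists (fun X G (h : pmod_hom (free_mod iota X) G) x => h (single iota x 1)).
split=> [X G | X X' G G' a b f].
  exists (@lift _ _ _ Runiv X G) => [h | v].
    by apply: (pmod_hom_free_eq Runiv) => x; rewrite lift_single.
  by apply/funext=> x; rewrite lift_single.
(* Naturality holds since [free_map] sends the basis vector at [x] to the one at [a x]. *)
apply/funext=> x; rewrite -[LHS]/(b (f (free_map Runiv a (single iota x 1)))).
by rewrite lift_single.
Qed.
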